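(* Let $d\ge 3$, let $\mathcal A\in\mathbb R^{n_1\times\cdots\times n_d}$ be a nonzero tensor, and let $0\le\omega_j<1/\sqrt{n_j}$ for $1\le j\le d$. Let $(\mathbf x_1^{\omega_1},\ldots,\mathbf x_d^{\omega_d})$ be any output of Algorithm V1 (described in the context) applied to $(\mathcal A,\omega_1,\ldots,\omega_d)$, and let $A_1\in\mathbb R^{n_1\times\prod_{j=2}^d n_j}$ be the unfolding of $\mathcal A$ formed in Step 1 of that algorithm. Then for every $(\tilde{\mathbf x}_1,\ldots,\tilde{\mathbf x}_d)$ with $\tilde{\mathbf x}_j\in\mathbb R^{n_j}$ and $\|\tilde{\mathbf x}_j\|=1$, $1\le j\le d$, $$\mathcal A\mathbf x_1^{\omega_1}\cdots\mathbf x_d^{\omega_d}\;\ge\;\frac{\prod_{j=1}^d\left(1-\omega_j\sqrt{n_j}+\omega_j\right)}{\sqrt{\prod_{j=2}^{d-1}n_j}}\,\lambda_{\max}(A_1)\;\ge\;\frac{\prod_{j=1}^d\left(1-\omega_j\sqrt{n_j}+\omega_j\right)}{\sqrt{\prod_{j=2}^{d-1}n_j}}\,\mathcal A\tilde{\mathbf x}_1\cdots\tilde{\mathbf x}_d .$$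
   Context: Notation. $\|\cdot\|$ is the Euclidean norm of vectors, $\lambda_{\max}(\cdot)$ is the largest singular value of a matrix, $\mathbf x(i)$ is the $i$-th entry of $\mathbf x$. For $\mathbf x_j\in\mathbb R^{n_j}$, $\mathcal A\mathbf x_1\cdots\mathbf x_d:=\langle\mathcal A,\mathbf x_1\circ\cdots\circ\mathbf x_d\rangle=\sum_{i_1,\ldots,i_d}\mathcal A(i_1,\ldots,i_d)\,\mathbf x_1(i_1)\cdots\mathbf x_d(i_d)$. Reshape. $\texttt{reshape}$ is the Matlab (column-major) operation: it rearranges the entries of an array into an array of the given size, keeping their order when entries are listed with the first index varying fastest. Thus $\texttt{reshape}(\mathcal A,n_1,\prod_{j=2}^dn_j)$ is the matrix whose row index is $i_1$ and whose column index is the multi-index $(i_2,\ldots,i_d)$ with $i_2$ varying fastest. Sparsification map. For $\mathbf a\in\mathbb R^n$ and $\omega\ge0$, let $S(\mathbf a,\omega)\in\mathbb R^n$ have entries $S(\mathbf a,\omega)(i)=\mathrm{sgn}(\mathbf a(i))\max\{|\mathbf a(i)|-\omega,0\}$. Define $N(\mathbf a,\omega)=S(\mathbf a,\omega)/\|S(\mathbf a,\omega)\|$ if $S(\mathbf a,\omega)\ne0$, and $N(\mathbf a,\omega)=\mathrm{sgn}(\mathbf a(\hat i))\,\mathbf e_{\hat i}$ if $S(\mathbf a,\omega)=0$, where $\hat i$ is any index with $|\mathbf a(\hat i)|=\max_i|\mathbf a(i)|$, $\mathbf e_{\hat i}$ is the $\hat i$-th standard basis vector, and in this last formula $\mathrm{sgn}(0)$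 is set to $1$. Algorithm V1, with input $\mathcal A\in\mathbb R^{n_1\times\cdots\times n_d}$ and $\omega_1,\ldots,\omega_d\ge0$: Step 1. Let $A_1=\texttt{reshape}(\mathcal A,n_1,\prod_{j=2}^dn_j)$. Let $(\mathbf x_1^*,\mathbf y_1^* )$ be any maximizer of $\mathbf x_1^\top A_1\mathbf y_1$ over $\mathbf x_1\in\mathbb R^{n_1}$, $\mathbf y_1\in\mathbb R^{\prod_{j=2}^dn_j}$ with $\|\mathbf x_1\|=\|\mathbf y_1\|=1$. Set $\mathbf x_1^{\omega_1}:=N(\mathbf x_1^*,\omega_1)$. Step 2. For $j=2,\ldots,d-1$: let $A_j=\texttt{reshape}(A_{j-1}^\top\mathbf x_{j-1}^{\omega_{j-1}},n_j,\prod_{k=j+1}^dn_k)\in\mathbb R^{n_j\times\prod_{k=j+1}^dn_k}$. Let $(\mathbf x_j^*,\mathbf y_j^* )$ be any maximizer of $\mathbf x_j^\top A_j\mathbf y_j$ over $\mathbf x_j\in\mathbb R^{n_j}$, $\mathbf y_j\in\mathbb R^{\prod_{k=j+1}^dn_k}$ with $\|\mathbf x_j\|=\|\mathbf y_j\|=1$. Set $\mathbf x_j^{\omega_j}:=N(\mathbf x_j^*,\omega_j)$. Step 3. Set $\mathbf x_d^*:=A_{d-1}^\top\mathbf x_{d-1}^{\omega_{d-1}}/\|A_{d-1}^\top\mathbf x_{d-1}^{\omega_{d-1}}\|\in\mathbb R^{n_d}$ and $\mathbf x_d^{\omega_d}:=N(\mathbf x_d^*,\omega_d)$. Step 4. Return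 $(\mathbf x_1^{\omega_1},\ldots,\mathbf x_d^{\omega_d})$. *)

(* Defs.v *)
From HB Require Import structures.
From mathcomp Require Import all_boot all_order all_algebra.
From mathcomp Require Import classical_sets reals.

Set Implicit Arguments.
Unset Strict Implicit.
Unset Printing Implicit Defensive.

Import Order.TTheory GRing.Theory Num.Theory.

Local Open Scope ring_scope.

(* Modes are numbered 1, ..., d: the j-th dimension is [n j] for 1 <= j <= d,
   and the values of [n], and of every family indexed by [nat] below, outside
   this range are irrelevant.  In a multi-index, the component of mode j is
   [idx j'] with j' : 'I_d of value j - 1. *)
Definition midx (d : nat) (n : nat -> nat) : finType :=
  {dffun forall j : 'I_d, 'I_(n j.+1)}.

Notation tensor R d n := {ffun midx d n -> R}.

(* <A, x_1 o ... o x_d> *)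
Definition multilin (R : realType) (d : nat) (n : nat -> nat)
    (A : tensor R d n) (x : forall j : nat, 'cV[R]_(n j)) : R :=
  \sum_(idx : midx d n) A idx * \prod_(j < d) x j.+1 (idx j) 0.

(* The sup norm is the library's norm on matrices; this is the Euclidean one. *)
Definition norm2 (R : realType) (m : nat) (v : 'cV[R]_m) : R :=
  Num.sqrt (\sum_(i < m) v i 0 ^+ 2).

(* The singular values of [M] are the square roots of the eigenvalues of
   M^T M.  For p < q this adds at most the value 0 to the list of the
   min(p, q) singular values, which does not change the largest one. *)
Definition singular_values (R : realType) (p q : nat) (M : 'M[R]_(p, q)) :
    set R :=
  [set s : R | 0 <= s /\ eigenvalue (M^T *m M) (s ^+ 2)]%classic.

(* This set is finite, and nonempty when 0 < q, so the supremum is a maximum. *)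
Definition lambda_max (R : realType) (p q : nat) (M : 'M[R]_(p, q)) : R :=
  sup (singular_values M).

(* The 0-based rank of a multi-index when the first component varies fastest. *)
Definition colmajor (d : nat) (n : nat -> nat) (idx : midx d n) : nat :=
  (\sum_(j < d) idx j * \prod_(1 <= k < j.+1) n k)%N.

Lemma colmajor_aux (n g h : nat -> nat) (m : nat) :
    (forall j, (j < m)%N -> (g j < n j.+1)%N) ->
    (forall j, (j < m)%N -> (h j < n j.+1)%N) ->
  [/\ (\sum_(j < m) g j * \prod_(1 <= k < j.+1) n k
         < \prod_(1 <= k < m.+1) n k)%N
    & (\sum_(j < m) g j * \prod_(1 <= k < j.+1) n k
       = \sum_(j < m) h j * \prod_(1 <= k < j.+1) n k)%N ->
      forall j, (j < m)%N -> g j = h j].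
Proof.
elim: m g h => [|m IH] g h Hg Hh.
  by split=> //; rewrite big_ord0 big_geq.
have w (f : nat -> nat) : (forall j, (j < m.+1)%N -> (f j < n j.+1)%N) ->
    forall j, (j < m)%N -> (f j < n j.+1)%N.
  by move=> Hf j jm; apply: Hf; apply: ltnW.
have [lg inj] := IH _ _ (w _ Hg) (w _ Hh).
have [lh _] := IH _ _ (w _ Hh) (w _ Hg).
rewrite !big_ord_recr /= [in X in (_ < X)%N]big_nat_recr //=.
move: lg lh inj; set P := (\prod_(1 <= k < m.+1) n k)%N.
set s := (\sum_(j < m) g j * _)%N; set t := (\sum_(j < m) h j * _)%N.
move=> lg lh inj; have P0 : (0 < P)%N by apply: leq_ltn_trans lg.
split.
  apply: (@leq_trans (P + g m * P)%N); first by rewrite ltn_add2r.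
  by rewrite -mulSn mulnC leq_mul2l Hg ?orbT.
move=> e.
have em : g m = h m.
  have := congr1 (divn^~ P) e.
  by rewrite /= !(addnC _ (_ * P)%N) !divnMDl // !divn_small // !addn0.
have es : s = t by apply: (@addIn (g m * P)%N); rewrite e em.
by move=> j; rewrite ltnS leq_eqVlt => /predU1P[->|/(inj es)].
Qed.

Definition midx_fun (d : nat) (n : nat -> nat) (idx : midx d n) (j : nat) : nat :=
  oapp (fun o : 'I_d => nat_of_ord (idx o)) 0%N (insub j).

Lemma midx_funE (d : nat) (n : nat -> nat) (idx : midx d n) (j : 'I_d) :
  midx_fun idx j = idx j.
Proof. by rewrite /midx_fun valK. Qed.

Lemma midx_fun_lt (d : nat) (n : nat -> nat) (idx : midx d n) (j : nat) :
  (j < d)%N -> (midx_fun idx j < n j.+1)%N.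
Proof. by move=> jd; rewrite -[j]/(val (Ordinal jd)) midx_funE. Qed.

Lemma colmajorE (d : nat) (n : nat -> nat) (idx : midx d n) :
  colmajor idx = (\sum_(j < d) midx_fun idx j * \prod_(1 <= k < j.+1) n k)%N.
Proof. by apply: eq_bigr => j _; rewrite midx_funE. Qed.

Lemma colmajor_lt (d : nat) (n : nat -> nat) (idx : midx d n) :
  (colmajor idx < \prod_(1 <= k < d.+1) n k)%N.
Proof.
rewrite colmajorE.
by case: (colmajor_aux (@midx_fun_lt _ _ idx) (@midx_fun_lt _ _ idx)).
Qed.

Lemma colmajor_inj (d : nat) (n : nat -> nat) : injective (@colmajor d n).
Proof.
move=> i1 i2; rewrite !colmajorE => e; apply/ffunP => j; apply: val_inj => /=.
have [_ /(_ e j (ltn_ord j))] :=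
  colmajor_aux (@midx_fun_lt _ _ i1) (@midx_fun_lt _ _ i2).
by rewrite !midx_funE.
Qed.

(* The entries of a tensor, listed with the first index varying fastest. *)
Definition tvec (R : realType) (d : nat) (n : nat -> nat) (A : tensor R d n) :
    'cV[R]_(\prod_(1 <= k < d.+1) n k) :=
  \col_r oapp A 0 [pick idx | colmajor idx == r].

(* By [colmajor_lt] and [colmajor_inj], this determines [tvec]. *)
Lemma tvecE (R : realType) (d : nat) (n : nat -> nat) (A : tensor R d n)
    (idx : midx d n) : tvec A (Ordinal (colmajor_lt idx)) 0 = A idx.
Proof.
rewrite mxE; case: pickP => [i /eqP/= /colmajor_inj -> //|].
by move=> /(_ idx); rewrite eqxx.
Qed.

(* Column-major reshape of a list of entries into a p x q matrix.  It is only
   meant to be used with m = p * q, and then the default 0 is never reached;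
   making it total avoids casts along equalities of dimensions. *)
Definition reshape (R : realType) (m p q : nat) (v : 'cV[R]_m) : 'M[R]_(p, q) :=
  \matrix_(i, c) oapp (fun r : 'I_m => v r 0) 0 (insub (i + p * c)%N).

Definition unfold1 (R : realType) (d : nat) (n : nat -> nat)
    (A : tensor R d n) : 'M[R]_(n 1%N, \prod_(2 <= k < d.+1) n k) :=
  reshape _ _ (tvec A).

Definition soft_threshold (R : realType) (m : nat) (a : 'cV[R]_m) (w : R) :
    'cV[R]_m :=
  \col_i (Num.sg (a i 0) * Num.max (`|a i 0| - w) 0).

Definition sgn1 (R : realType) (t : R) : R := if t == 0 then 1 else Num.sg t.

(* [is_N a w z]: z is a possible value of N(a, w), over all choices of the
   index of an entry of largest modulus. *)
Definition is_N (R : realType) (m : nat) (a : 'cV[R]_m) (w : R)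
    (z : 'cV[R]_m) : Prop :=
  let S := soft_threshold a w in
  (S != 0 -> z = (norm2 S)^-1 *: S) /\
  (S = 0 -> exists i : 'I_m,
     (forall k : 'I_m, `|a k 0| <= `|a i 0|) /\
     z = sgn1 (a i 0) *: delta_mx i 0).

Definition bilin (R : realType) (p q : nat) (M : 'M[R]_(p, q))
    (x : 'cV[R]_p) (y : 'cV[R]_q) : R := (x^T *m M *m y) 0 0.

Definition is_maximizer (R : realType) (p q : nat) (M : 'M[R]_(p, q))
    (x : 'cV[R]_p) (y : 'cV[R]_q) : Prop :=
  [/\ norm2 x = 1, norm2 y = 1 &
      forall (x' : 'cV[R]_p) (y' : 'cV[R]_q),
        norm2 x' = 1 -> norm2 y' = 1 -> bilin M x' y' <= bilin M x y].

(* [V1_output A w x]: (x 1, ..., x d) is returned by some run of the algorithm.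
   [As j] is the matrix A_j (only used for j < d), [(xs j, ys j)] the chosen
   maximizer, and [xs d] the vector x_d^*, where the reshape to a single column
   only identifies the dimension \prod_(d <= k < d.+1) n k with n d. *)
Definition V1_output (R : realType) (d : nat) (n : nat -> nat)
    (A : tensor R d n) (w : nat -> R) (x : forall j : nat, 'cV[R]_(n j)) : Prop :=
  exists (As : forall j : nat, 'M[R]_(n j, \prod_(j.+1 <= k < d.+1) n k))
         (xs : forall j : nat, 'cV[R]_(n j))
         (ys : forall j : nat, 'cV[R]_(\prod_(j.+1 <= k < d.+1) n k)),
  let v := (As d.-1)^T *m x d.-1 in
  [/\ As 1%N = unfold1 A,
      forall j : nat, (2 <= j < d)%N ->
        As j = reshape _ _ ((As j.-1)^T *m x j.-1),
      forall j : nat, (1 <= j < d)%N -> is_maximizer (As j) (xs j) (ys j),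
      xs d = (norm2 v)^-1 *: reshape (n d) 1 v
    & forall j : nat, (1 <= j <= d)%N -> is_N (xs j) (w j) (x j)].

(* Main.v *)
(* If (a, b) is a unit maximizer of x^T M y, with value l = lambda_max(M), then
   M b = l a; hence, for z = N(a, w), |M^T z| >= <M^T z, b> = l <a, z>, and
   <a, z> >= 1 - w sqrt n + w.  Moreover each of the n rows of M has norm at
   most l, so l >= |M|_F / sqrt n.  As reshaping preserves the Frobenius norm,
   passing from the contraction A_(j-1)^T x_(j-1) to A_j^T x_j multiplies the
   norm by at least (1 - w_j sqrt n_j + w_j) / sqrt n_j, and the value of the
   output is the inner product of the last contraction with x_d.  The second
   inequality holds because a Kronecker product of unit vectors is a unit
   vector. *)

Require Import Defs.
From mathcomp Require Import all_boot all_order all_algebra.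
From mathcomp Require Import classical_sets reals.
From mathcomp Require Import ring lra.

Import Order.TTheory GRing.Theory Num.Theory.

Local Open Scope ring_scope.

Set Implicit Arguments.
Unset Strict Implicit.

(** * Euclidean inner product and soft thresholding *)

Definition dot (R : realType) (m : nat) (u v : 'cV[R]_m) : R :=
  \sum_(i < m) u i 0 * v i 0.

Section Euclidean.
Variables (R : realType) (m : nat).
Implicit Types (u v a z : 'cV[R]_m) (k w : R).

Lemma dotC u v : dot u v = dot v u.
Proof. by apply: eq_bigr => i _; rewrite mulrC. Qed.

Lemma dotDl u v a : dot (u + v) a = dot u a + dot v a.
Proof. by rewrite -big_split; apply: eq_bigr => i _; rewrite !mxE mulrDl. Qed.

Lemma dotZl k u v : dot (k *: u) v = k * dot u v.
Proof. by rewrite mulr_sumr; apply: eq_bigr => i _; rewrite !mxE mulrA. Qed.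

Lemma dotDr u v a : dot a (u + v) = dot a u + dot a v.
Proof. by rewrite !(dotC a) dotDl. Qed.

Lemma dotZr k u v : dot u (k *: v) = k * dot u v.
Proof. by rewrite !(dotC u) dotZl. Qed.

Lemma dotNl u v : dot (- u) v = - dot u v.
Proof. by rewrite -scaleN1r dotZl mulN1r. Qed.

Lemma dotNr u v : dot u (- v) = - dot u v.
Proof. by rewrite dotC dotNl dotC. Qed.

Lemma dot_ge0 u : 0 <= dot u u.
Proof. by apply: sumr_ge0 => i _; rewrite -expr2 sqr_ge0. Qed.

Lemma dot_eq0 u : dot u u = 0 -> u = 0.
Proof.
move=> /eqP; rewrite psumr_eq0 => [/allP u0|i _]; last by rewrite -expr2 sqr_ge0.
apply/colP => i; rewrite !mxE; apply/eqP.
by have := u0 i (mem_index_enum _); rewrite /= mulf_eq0 orbb.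
Qed.

Lemma norm2_dot u : norm2 u = Num.sqrt (dot u u).
Proof. by congr Num.sqrt; apply: eq_bigr => i _; rewrite expr2. Qed.

Lemma norm2_ge0 u : 0 <= norm2 u.
Proof. exact: sqrtr_ge0. Qed.

Lemma sqr_norm2 u : norm2 u ^+ 2 = dot u u.
Proof. by rewrite norm2_dot sqr_sqrtr ?dot_ge0. Qed.

Lemma norm2_eq0 u : norm2 u = 0 -> u = 0.
Proof. by move=> u0; apply: dot_eq0; rewrite -sqr_norm2 u0 expr0n. Qed.

Lemma norm2_gt0 u : u != 0 -> 0 < norm2 u.
Proof.
by move=> u0; rewrite lt0r norm2_ge0 andbT; apply: contra u0 => /eqP/norm2_eq0->.
Qed.

Lemma norm2Z k u : norm2 (k *: u) = `|k| * norm2 u.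
Proof.
by rewrite !norm2_dot dotZl dotZr mulrA -expr2 sqrtrM ?sqr_ge0 // sqrtr_sqr.
Qed.

Lemma norm2_normalized u : u != 0 -> norm2 ((norm2 u)^-1 *: u) = 1.
Proof.
move=> /norm2_gt0 u0; rewrite norm2Z ger0_norm ?invr_ge0 ?norm2_ge0 //.
by rewrite mulVf ?gt_eqF.
Qed.

Lemma cauchy_schwarz u v : dot u v <= norm2 u * norm2 v.
Proof.
have [->|v0] := eqVneq v 0.
  by rewrite -[X in dot _ X](scale0r 0) dotZr mul0r mulr_ge0 ?norm2_ge0.
have [->|u0] := eqVneq u 0.
  by rewrite -[X in dot X _](scale0r 0) dotZl mul0r mulr_ge0 ?norm2_ge0.
have nu := norm2_gt0 u0; have nv := norm2_gt0 v0.
(* Expanded, this reads [2 |u| |v| (|u| |v| - <u, v>) >= 0]. *)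
have := dot_ge0 (norm2 v *: u - norm2 u *: v).
rewrite dotDl !dotDr !dotNl !dotNr !dotZl !dotZr -!sqr_norm2 (dotC v u).
have pos : 0 < norm2 u * norm2 v by rewrite mulr_gt0.
move=> H; rewrite -(ler_pM2l pos); lra.
Qed.

Lemma norm2D u v : norm2 (u + v) <= norm2 u + norm2 v.
Proof.
rewrite -ler_sqr ?nnegrE ?addr_ge0 ?norm2_ge0 //.
rewrite sqr_norm2 dotDl !dotDr (dotC v u) sqrrD !sqr_norm2.
have := cauchy_schwarz u v; lra.
Qed.

(** If [|a_i| > w], the residual is [sgn(a_i) w]; otherwise [S_i = 0]. Summed over [i], the two
    facts give [<a, S> = |S|^2 + w |S|_1] and [|a - S| <= w sqrt m]. *)
Lemma soft_threshold_residual a w (i : 'I_m) : 0 <= w ->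
  let S := soft_threshold a w in
  (S i 0 * a i 0 = S i 0 ^+ 2 + w * `|S i 0|) /\ (a i 0 - S i 0) ^+ 2 <= w ^+ 2.
Proof.
move=> w0 /=; rewrite mxE; set t := a i 0.
have [wt|tw] := ltP w `|t|.
  have s0 : 0 <= `|t| - w by rewrite subr_ge0 ltW.
  have tn0 : t != 0 by rewrite -normr_gt0 (le_lt_trans w0).
  rewrite /Num.max ifF ?ltNge ?s0 // normrM normr_sg tn0 mul1r (ger0_norm s0).
  have sg2 : Num.sg t ^+ 2 = 1 by rewrite sqr_sg tn0.
  have te : t = Num.sg t * `|t| by rewrite -numEsg.
  set s := Num.sg t in sg2 te *; set b := `|t| in s0 te *.
  split; first by rewrite {1}te; ring: sg2.
  by rewrite te; rewrite le_eqVlt; apply/orP; left; apply/eqP; ring: sg2.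
have s0 : `|t| - w <= 0 by rewrite subr_le0.
rewrite (max_idPr s0) mulr0 subr0 normr0 mul0r; split; first by ring.
by rewrite -(real_normK (num_real t)) ler_sqr ?nnegrE.
Qed.

Lemma norm2_soft_threshold a w : 0 <= w ->
  norm2 a - w * Num.sqrt m%:R <= norm2 (soft_threshold a w).
Proof.
move=> w0; set S := soft_threshold a w.
have : norm2 (a - S) <= w * Num.sqrt m%:R.
  rewrite -[w]ger0_norm // -sqrtr_sqr -sqrtrM ?sqr_ge0 // ler_wsqrtr //.
  rewrite mulr_natr -[X in _ *+ X]card_ord -sumr_const; apply: ler_sum => i _.
  by have [_] := soft_threshold_residual a i w0; rewrite !mxE.
have := norm2D (a - S) S; rewrite subrK; lra.
Qed.

Lemma dot_soft_threshold a w : 0 <= w ->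
  norm2 (soft_threshold a w) * (norm2 (soft_threshold a w) + w)
  <= dot a (soft_threshold a w).
Proof.
move=> w0; set S := soft_threshold a w; set s := norm2 S.
pose l1 := \sum_(i < m) `|S i 0|.
have -> : dot a S = s ^+ 2 + w * l1.
  rewrite sqr_norm2 mulr_sumr -big_split; apply: eq_bigr => i _ /=.
  by have [e _] := soft_threshold_residual a i w0; rewrite mulrC e expr2.
(* The Euclidean norm is at most the l1 norm, because [|S_i|^2 <= |S_i| * l1]. *)
suff : s <= l1 by move=> h; rewrite mulrDr expr2 lerD2l mulrC ler_wpM2l.
rewrite -ler_sqr ?nnegrE ?norm2_ge0 ?sumr_ge0 //.
rewrite sqr_norm2 expr2 mulr_suml; apply: ler_sum => i _.
rewrite -expr2 -(real_normK (num_real (S i 0))) expr2 ler_wpM2l //.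
by rewrite /l1 (bigD1 i) //= lerDl sumr_ge0.
Qed.

Lemma soft_threshold_weight_lt1 w : 0 <= w < 1 / Num.sqrt (m%:R : R) ->
  0 < 1 - w * Num.sqrt m%:R.
Proof.
case/andP=> w0; have [->|mpos] := posnP m.
  by rewrite sqrtr0 mulr0 subr0 ltr01.
by rewrite ltr_pdivlMr ?sqrtr_gt0 ?ltr0n // subr_gt0.
Qed.

(* Writing S = S(a, w), one has <a, S> = |S|^2 + w |S|_1 >= |S| (|S| + w) and
   |S| >= 1 - w sqrt m > 0, so that the degenerate branch of N never occurs. *)
Lemma dot_is_N a w z : norm2 a = 1 -> 0 <= w < 1 / Num.sqrt (m%:R : R) ->
  is_N a w z -> 1 - w * Num.sqrt m%:R + w <= dot a z.
Proof.
move=> a1 hw [zE _]; have w0 : 0 <= w by case/andP: hw.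
have sm := norm2_soft_threshold a w0; rewrite a1 in sm.
have s0 := lt_le_trans (soft_threshold_weight_lt1 hw) sm.
have Sn0 : soft_threshold a w != 0.
  apply: contraTneq s0 => ->; rewrite -(scale0r 0) norm2Z normr0 mul0r.
  by rewrite ltxx.
rewrite zE // dotZr ler_pdivlMl //.
apply: le_trans (dot_soft_threshold a w0).
by rewrite ler_pM2l // lerD2r.
Qed.

End Euclidean.

(** * Unit maximizers of a bilinear form and the largest singular value *)

Section Maximizer.
Variables (R : realType) (p q : nat).
Implicit Types (M : 'M[R]_(p, q)) (x : 'cV[R]_p) (y : 'cV[R]_q).

Lemma bilin_dotr M x y : bilin M x y = dot x (M *m y).
Proof. by rewrite /bilin -mulmxA mxE; apply: eq_bigr => i _; rewrite mxE. Qed.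

Lemma bilin_dotl M x y : bilin M x y = dot (M^T *m x) y.
Proof.
by rewrite /bilin mxE; apply: eq_bigr => i _; rewrite -{1}(trmxK M) -trmx_mul mxE.
Qed.

Lemma maximizer_ge0 M x y : is_maximizer M x y -> 0 <= bilin M x y.
Proof.
(* Replacing [x] by [- x] negates the value. *)
case=> x1 y1 /(_ (- x) y); rewrite -scaleN1r norm2Z normrN1 mul1r.
move=> /(_ x1 y1); rewrite !bilin_dotr dotZl; lra.
Qed.

(** The maximum is the operator norm of [M]: the normalizations of [M y'] and [y'] form a competing
    pair of value [|M y'| / |y'|]. *)
Lemma norm2_mulmx_maximizer M x y : is_maximizer M x y ->
  forall y', norm2 (M *m y') <= bilin M x y * norm2 y'.
Proof.
move=> mx y'; have l0 := maximizer_ge0 mx; case: mx => _ _ mx.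
have [->|My0] := eqVneq (M *m y') 0.
  by rewrite -(scale0r 0) norm2Z normr0 mul0r mulr_ge0 ?norm2_ge0.
have y0 : y' != 0 by apply: contraNneq My0 => ->; rewrite mulmx0.
have [nM ny] := (norm2_gt0 My0, norm2_gt0 y0).
have := mx _ _ (norm2_normalized My0) (norm2_normalized y0).
rewrite [X in X <= _]bilin_dotr -scalemxAr dotZl dotZr -sqr_norm2.
rewrite mulrCA expr2 mulKf ?gt_eqF // ler_pdivrMl //.
by rewrite mulrC.
Qed.

(** With [l] the maximum, [|M y - l x|^2 = |M y|^2 - l^2], which the operator norm bound makes
    nonpositive. *)
Lemma maximizer_mulmx M x y : is_maximizer M x y -> M *m y = bilin M x y *: x.
Proof.
move=> mx; have le := norm2_mulmx_maximizer mx y.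
have l0 := maximizer_ge0 mx; case: mx => x1 y1 _.
apply/eqP; rewrite -subr_eq0; apply/eqP/dot_eq0/eqP.
rewrite eq_le dot_ge0 andbT.
move: le; rewrite y1 mulr1 -ler_sqr ?nnegrE ?norm2_ge0 // sqr_norm2.
rewrite !(dotDl, dotDr, dotNl, dotNr, dotZl, dotZr) (dotC (M *m y) x).
rewrite -(bilin_dotr M x) -(sqr_norm2 x) x1; lra.
Qed.

Lemma ge_norm2_mulmx_maximizer M x y z : is_maximizer M x y ->
  bilin M x y * dot x z <= norm2 (M^T *m z).
Proof.
move=> mx; have := cauchy_schwarz (M^T *m z) y.
rewrite -bilin_dotl bilin_dotr (maximizer_mulmx mx) dotZr (dotC z).
by case: mx => _ -> _; rewrite mulr1.
Qed.

Lemma frobenius_le_maximizer M x y : is_maximizer M x y ->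
  Num.sqrt (\sum_(i < p) \sum_(j < q) M i j ^+ 2)
  <= Num.sqrt p%:R * bilin M x y.
Proof.
move=> mx; have l0 := maximizer_ge0 mx.
rewrite -[bilin M x y](ger0_norm l0) -sqrtr_sqr -sqrtrM ?ler0n // ler_wsqrtr //.
rewrite mulr_natl -[X in _ *+ X]card_ord -sumr_const; apply: ler_sum => i _.
have rowE : dot (row i M)^T (row i M)^T = \sum_(j < q) M i j ^+ 2.
  by apply: eq_bigr => j _; rewrite !mxE expr2.
have [r0|r0] := eqVneq (row i M)^T 0.
  rewrite -rowE r0 -[X in dot X _](scale0r 0) dotZl mul0r; exact: sqr_ge0.
rewrite -rowE -sqr_norm2 ler_sqr ?nnegrE ?norm2_ge0 //.
have e1 : norm2 (delta_mx i 0 : 'cV[R]_p) = 1.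
  rewrite /norm2 (bigD1 i) //= mxE !eqxx big1 ?addr0 ?expr1n ?sqrtr1 //.
  by move=> k /negPf ki; rewrite mxE ki expr0n.
(* The competing pair is the [i]-th basis vector with the normalized [i]-th row; its value is the
   norm of that row. *)
case: mx => _ _ /(_ _ _ e1 (norm2_normalized r0)).
rewrite [X in X <= _]bilin_dotl dotZr.
have -> : M^T *m delta_mx i 0 = (row i M)^T by rewrite -colE tr_row.
by rewrite -sqr_norm2 expr2 mulKf // gt_eqF // norm2_gt0.
Qed.

End Maximizer.

Lemma maximizer_tr (R : realType) (p q : nat) (M : 'M[R]_(p, q)) x y :
  is_maximizer M x y -> is_maximizer M^T y x.
Proof.
case=> x1 y1 mx; split=> // y' x' y1' x1'.
by rewrite !bilin_dotl trmxK !(dotC (M *m _)) -!bilin_dotr; exact: mx.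
Qed.

(** With [l] the maximum, an eigenvector [v] of [M^T M] for [s^2] has [|M v| = s |v|], so [s <= l].
    Conversely [M y = l x] and [M^T x = l y] make [y] an eigenvector for [l^2]. Eigenvectors are
    rows here, hence the transposes. *)
Lemma lambda_max_maximizer (R : realType) (p q : nat) (M : 'M[R]_(p, q)) x y :
  is_maximizer M x y -> lambda_max M = bilin M x y.
Proof.
move=> mx; have l0 := maximizer_ge0 mx; have My := maximizer_mulmx mx.
have Mx := maximizer_mulmx (maximizer_tr mx).
have lE : bilin M^T y x = bilin M x y.
  by rewrite bilin_dotl trmxK dotC -bilin_dotr.
rewrite lE in Mx.
have ub : ubound (singular_values M) (bilin M x y).
  move=> s [s0 /eigenvalueP[v vE v0]].
  have vt0 : v^T != 0 by rewrite -[0]trmx0 (inj_eq trmx_inj).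
  have := norm2_mulmx_maximizer mx v^T.
  suff -> : norm2 (M *m v^T) = s * norm2 v^T by rewrite ler_pM2r // norm2_gt0.
  rewrite norm2_dot -bilin_dotr bilin_dotl mulmxA.
  have -> : M^T *m M *m v^T = s ^+ 2 *: v^T.
    by rewrite -linearZ /= -vE !trmx_mul trmxK.
  by rewrite dotZl sqrtrM ?sqr_ge0 // sqrtr_sqr ger0_norm // -norm2_dot.
have mem : singular_values M (bilin M x y).
  split=> //; apply/eigenvalueP; exists y^T; last first.
    rewrite -[0]trmx0 (inj_eq trmx_inj); apply: contra_eqN (erefl (norm2 y)).
    case: mx => _ y1 _ /eqP y0; move: y1; rewrite y0 -(scale0r 0) norm2Z normr0.
    by rewrite mul0r => /esym/eqP; rewrite oner_eq0.
  apply: trmx_inj; rewrite linearZ /= !trmx_mul !trmxK -mulmxA My.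
  by rewrite -scalemxAr Mx scalerA.
apply/eqP; rewrite eq_le; apply/andP; split.
  by apply: ge_sup => //; exists (bilin M x y).
by apply: ub_le_sup => //; exists (bilin M x y).
Qed.

(** * Reshaping as arithmetic on natural-number positions *)

Definition entry (R : realType) (m : nat) (v : 'cV[R]_m) (r : nat) : R :=
  oapp (fun i : 'I_m => v i 0) 0 (insub r).

Lemma entryE (R : realType) (m : nat) (v : 'cV[R]_m) (i : 'I_m) :
  entry v i = v i 0.
Proof. by rewrite /entry valK. Qed.

Lemma dot_entry (R : realType) (m : nat) (u v : 'cV[R]_m) :
  dot u v = \sum_(0 <= r < m) entry u r * entry v r.
Proof. by rewrite big_mkord; apply: eq_bigr => i _; rewrite !entryE. Qed.

Lemma sum_mulnE (R : realType) (p q : nat) (F : nat -> R) :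
  \sum_(0 <= r < p * q) F r = \sum_(c < q) \sum_(i < p) F (i + p * c)%N.
Proof.
rewrite mulnC big_nat_mul big_mkord; apply: eq_bigr => c _.
rewrite mulSn -[X in \sum_(X <= _ < _) _]add0n big_addn addnK big_mkord.
by apply: eq_bigr => i _; rewrite mulnC.
Qed.

(** One contraction step of the algorithm: position [r = i + p * c] is row [i], column [c] of the
    reshaped matrix. The weight [G] stands for the modes not yet contracted. *)
Lemma sum_reshape (R : realType) (m p q : nat) (v : 'cV[R]_m) (u : 'cV[R]_p)
    (G : nat -> R) : m = (p * q)%N ->
  \sum_(0 <= r < m) entry v r * (entry u (r %% p)%N * G (r %/ p)%N)
  = \sum_(0 <= c < q) entry ((Defs.reshape p q v)^T *m u) c * G c.
Proof.
move=> mE; rewrite [X in \sum_(0 <= _ < X) _]mE sum_mulnE big_mkord.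
apply: eq_bigr => c _; rewrite entryE mxE mulr_suml; apply: eq_bigr => i _.
have p0 : (0 < p)%N by apply: leq_ltn_trans (ltn_ord i).
rewrite addnC mulnC modnMDl divnMDl // modn_small // divn_small // addn0 entryE.
by rewrite !mxE mulrA addnC mulnC.
Qed.

Lemma sum_sqr_reshape (R : realType) (m p q : nat) (v : 'cV[R]_m) :
  m = (p * q)%N ->
  \sum_(i < p) \sum_(j < q) Defs.reshape p q v i j ^+ 2 = dot v v.
Proof.
move=> mE; rewrite dot_entry [X in \sum_(0 <= _ < X) _]mE sum_mulnE.
rewrite exchange_big; apply: eq_bigr => j _; apply: eq_bigr => i _.
by rewrite mxE expr2.
Qed.

(** * Kronecker products in column-major order *)

Section Kronecker.
Variables (R : realType) (n : nat -> nat).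
Implicit Type x : forall j : nat, 'cV[R]_(n j).

(* Entry [r] of the Kronecker product of x_s, ..., x_(s+m-1), the digits of [r]
   in mixed radix n_s, ..., n_(s+m-1) being read least significant first. *)
Fixpoint kron x (m s r : nat) : R :=
  if m is m'.+1 then entry (x s) (r %% n s)%N * kron x m' s.+1 (r %/ n s)%N
  else 1.

Lemma kronS x m s i c : (i < n s)%N ->
  kron x m.+1 s (i + n s * c)%N = entry (x s) i * kron x m s.+1 c.
Proof.
move=> lt_i /=; have n0 : (0 < n s)%N by apply: leq_ltn_trans lt_i.
by rewrite addnC mulnC modnMDl divnMDl // modn_small // divn_small // addn0.
Qed.

Arguments kron : simpl never.

Lemma kron_digits x m s (g : nat -> nat) :
    (forall j, (j < m)%N -> (g j < n (s + j))%N) ->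
  kron x m s (\sum_(j < m) g j * \prod_(s <= k < s + j) n k)%N
  = \prod_(j < m) entry (x (s + j)%N) (g j).
Proof.
elim: m s g => [|m IH] s g Hg; first by rewrite !big_ord0.
rewrite !big_ord_recl /= addn0 big_geq // muln1.
(* Beyond the least significant digit, every place value contains the factor [n s]. *)
have -> : (\sum_(i < m) g (bump 0 i) * \prod_(s <= k < s + bump 0 i) n k
    = n s * \sum_(i < m) g i.+1 * \prod_(s.+1 <= k < s.+1 + i) n k)%N.
  rewrite big_distrr; apply: eq_bigr => i _; rewrite /bump add1n addnS /=.
  by rewrite big_ltn ?ltnS ?leq_addr // addSn mulnCA.
rewrite kronS; last by have := Hg 0%N; rewrite addn0; exact.
rewrite (IH _ (fun j => g j.+1)) => [|j jm]; last by rewrite addSn -addnS; exact: Hg.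
by congr (_ * _); apply: eq_bigr => i _; rewrite /bump add1n addnS addSn.
Qed.

Lemma sum_sqr_kron x m s :
  \sum_(0 <= r < \prod_(s <= k < s + m) n k) kron x m s r ^+ 2
  = \prod_(s <= k < s + m) norm2 (x k) ^+ 2.
Proof.
elim: m s => [|m IH] s.
  by rewrite addn0 !(@big_geq _ _ _ s s) // big_nat1 expr1n.
rewrite addnS !(@big_ltn _ _ _ s) ?ltnS ?leq_addr // -addSn -IH sum_mulnE.
rewrite big_mkord mulr_sumr; apply: eq_bigr => c _.
rewrite sqr_norm2 mulr_suml; apply: eq_bigr => i _.
by rewrite kronS // entryE exprMn expr2.
Qed.

Lemma multilin_kron d (A : tensor R d n) x :
  multilin A x = \sum_(0 <= r < \prod_(1 <= k < d.+1) n k)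
                   entry (tvec A) r * kron x d 1 r.
Proof.
have kE (idx : midx d n) :
    \prod_(j < d) x j.+1 (idx j) 0 = kron x d 1 (colmajor idx).
  rewrite colmajorE kron_digits; last exact: midx_fun_lt.
  by apply: eq_bigr => j _; rewrite midx_funE entryE.
rewrite big_mkord /multilin.
(* Each multi-index is paired with its rank and the sums are exchanged. Surjectivity of the ranking
   is bypassed: at a position that is no rank, [tvec] is 0 and the inner sum is empty. *)
transitivity (\sum_(idx : midx d n) \sum_(r < \prod_(1 <= k < d.+1) n k |
    colmajor idx == r) A idx * kron x d 1 r).
  by apply: eq_bigr => idx _; rewrite kE (big_pred1 (Ordinal (colmajor_lt idx))) //.
rewrite (exchange_big_dep xpredT) //=; apply: eq_bigr => r _.
rewrite entryE mxE; case: pickP => [idx0 /eqP e|none] /=; last first.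
  by rewrite mul0r big_pred0.
rewrite (big_pred1 idx0) // => idx; rewrite -e; apply/eqP/eqP => [|-> //].
exact: colmajor_inj.
Qed.

End Kronecker.

Lemma multilin_unfold1 (R : realType) (e : nat) (n : nat -> nat)
    (A : tensor R e.+1 n) (x : forall j : nat, 'cV[R]_(n j)) :
  multilin A x = bilin (unfold1 A) (x 1%N) (\col_c kron x e 2 c).
Proof.
rewrite multilin_kron /kron -/(kron _).
rewrite (@sum_reshape _ _ _ (\prod_(2 <= k < e.+2) n k)).
  rewrite bilin_dotl dot_entry !big_mkord; apply: eq_bigr => c _.
  by rewrite !entryE mxE.
by rewrite big_ltn.
Qed.

Lemma multilin_le_maximizer (R : realType) (e : nat) (n : nat -> nat)
    (A : tensor R e.+1 n) (x : forall j : nat, 'cV[R]_(n j)) xs ys :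
    (forall j : nat, (1 <= j <= e.+1)%N -> norm2 (x j) = 1) ->
    is_maximizer (unfold1 A) xs ys ->
  multilin A x <= bilin (unfold1 A) xs ys.
Proof.
move=> x1 [_ _ mx]; rewrite multilin_unfold1; apply: mx; first exact: x1.
apply/eqP; rewrite -sqrp_eq1 ?norm2_ge0 // sqr_norm2.
transitivity (\sum_(0 <= r < \prod_(2 <= k < e.+2) n k) kron x e 2 r ^+ 2 == 1).
  by rewrite big_mkord; congr (_ == _); apply: eq_bigr => i _; rewrite mxE expr2.
rewrite (sum_sqr_kron x e 2); apply/eqP.
rewrite big_nat big1 // => j /andP[j2 je]; rewrite x1 ?expr1n //.
by rewrite (ltnW j2).
Qed.

(** * Successive contractions of the tensor *)

Section Residuals.
Variables (R : realType) (d : nat) (n : nat -> nat) (A : tensor R d n).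
Variable As : forall j : nat, 'M[R]_(n j, \prod_(j.+1 <= k < d.+1) n k).
Variable x : forall j : nat, 'cV[R]_(n j).

(* The list of entries that the algorithm reshapes into A_(j+1), which is what
   remains of the tensor after contracting its first j modes with x_1, ..., x_j. *)
Definition residual (j : nat) : 'cV[R]_(\prod_(j.+1 <= k < d.+1) n k) :=
  match j with
  | 0 => tvec A
  | j'.+1 => (As j'.+1)^T *m x j'.+1
  end.

Hypothesis As1 : As 1%N = unfold1 A.
Hypothesis AsS : forall j : nat, (2 <= j < d)%N ->
  As j = Defs.reshape _ _ ((As j.-1)^T *m x j.-1).

Lemma unfolding_residual j : (j.+1 < d)%N ->
  As j.+1 = Defs.reshape _ _ (residual j).
Proof. by case: j => [|j] jd //; rewrite AsS. Qed.

(** Invariant of the algorithm: contracting one more mode moves one Kronecker factor into the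
    residual, by [sum_reshape]. *)
Lemma multilin_residual j : (j < d)%N ->
  multilin A x = \sum_(0 <= r < \prod_(j.+1 <= k < d.+1) n k)
                   entry (residual j) r * kron x (d - j) j.+1 r.
Proof.
elim: j => [|j IH] jd; first by rewrite subn0 multilin_kron.
rewrite (IH (ltnW jd)) -subnSK ?(ltnW jd) // /kron -/(kron _).
rewrite (@sum_reshape _ _ _ (\prod_(j.+2 <= k < d.+1) n k)).
  by rewrite -unfolding_residual.
by rewrite big_ltn // ltnS ltnW.
Qed.

End Residuals.

(** * Lower bounds along the run of the algorithm *)

Lemma is_N_factor_gt0 (R : realType) (m : nat) (w : R) :
  0 <= w < 1 / Num.sqrt (m%:R : R) -> 0 < 1 - w * Num.sqrt m%:R + w.
Proof.
by move=> hw; have := soft_threshold_weight_lt1 hw; case/andP: hw => w0 _; lra.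
Qed.

(** This is [dot_is_N] scaled by [|v|]; at [v = 0] both sides vanish. *)
Lemma dot_normalized_is_N (R : realType) (m : nat) (w : R) (v z : 'cV[R]_m) :
    0 <= w < 1 / Num.sqrt (m%:R : R) -> is_N ((norm2 v)^-1 *: v) w z ->
  (1 - w * Num.sqrt m%:R + w) * norm2 v <= dot v z.
Proof.
move=> hw hz; have [->|v0] := eqVneq v 0.
  by rewrite -(scale0r 0) norm2Z dotZl normr0 !mul0r mulr0.
have := dot_is_N (norm2_normalized v0) hw hz.
by rewrite dotZl ler_pdivlMl ?norm2_gt0 // mulrC.
Qed.

Lemma norm2_column (R : realType) (m p : nat) (v : 'cV[R]_m) :
  m = p -> norm2 (Defs.reshape p 1 v) = norm2 v.
Proof.
move=> mp; rewrite [RHS]norm2_dot -(@sum_sqr_reshape _ _ p 1) ?muln1 //.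
by congr Num.sqrt; apply: eq_bigr => i _; rewrite big_ord1.
Qed.

(** The remainder modulo [p] is harmless for [r < p]; it is the form in which a one-factor [kron]
    reads its entry. *)
Lemma dot_column (R : realType) (m p : nat) (v : 'cV[R]_m) (u : 'cV[R]_p) :
    m = p ->
  dot (Defs.reshape p 1 v) u = \sum_(0 <= r < m) entry v r * entry u (r %% p)%N.
Proof.
move=> mp; rewrite [X in \sum_(0 <= _ < X) _]mp big_mkord; apply: eq_bigr => i _.
by rewrite modn_small // entryE mxE muln0 addn0.
Qed.

Section Output.
Variables (R : realType) (e : nat) (n : nat -> nat) (A : tensor R e.+1 n).
Variables (w : nat -> R) (x : forall j : nat, 'cV[R]_(n j)).
Hypothesis hw : forall j : nat, (1 <= j <= e.+1)%N ->
  0 <= w j < 1 / Num.sqrt ((n j)%:R : R).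
Variable As : forall j : nat, 'M[R]_(n j, \prod_(j.+1 <= k < e.+2) n k).
Variables (xs : forall j : nat, 'cV[R]_(n j))
  (ys : forall j : nat, 'cV[R]_(\prod_(j.+1 <= k < e.+2) n k)).
Hypothesis As1 : As 1%N = unfold1 A.
Hypothesis AsS : forall j : nat, (2 <= j < e.+1)%N ->
  As j = Defs.reshape _ _ ((As j.-1)^T *m x j.-1).
Hypothesis mxs : forall j : nat, (1 <= j < e.+1)%N ->
  is_maximizer (As j) (xs j) (ys j).
Hypothesis xN : forall j : nat, (1 <= j <= e.+1)%N -> is_N (xs j) (w j) (x j).

Let f j := 1 - w j * Num.sqrt (n j)%:R + w j.

(** As [0^-1 = 0], the hypothesis [hw] would read [0 <= w j < 0] if [n j = 0]. *)
Let n_gt0 j : (1 <= j <= e.+1)%N -> (0 < n j)%N.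
Proof.
move=> /hw; case: (n j) => // /andP[w0]; rewrite sqrtr0 invr0 mulr0.
by rewrite ltNge w0.
Qed.

Lemma norm2_residualS j : (j < e)%N ->
  f j.+1 * bilin (As j.+1) (xs j.+1) (ys j.+1) <= norm2 (residual A As x j.+1).
Proof.
move=> je; have mx := mxs (j := j.+1) je.
have j1e : (1 <= j.+1 <= e.+1)%N by exact: ltnW.
apply: le_trans (ge_norm2_mulmx_maximizer (x j.+1) mx).
rewrite mulrC ler_wpM2l ?(maximizer_ge0 mx) //.
by apply: dot_is_N (xN j1e); [case: mx | exact: hw].
Qed.

Lemma norm2_residual_ge j : (j < e)%N ->
  (\prod_(1 <= k < j.+2) f k) / Num.sqrt (\prod_(2 <= k < j.+2) n k)%:R
    * bilin (As 1%N) (xs 1%N) (ys 1%N)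
  <= norm2 (residual A As x j.+1).
Proof.
elim: j => [|j IH] je.
  (* The first step uses the maximum for [As 1] directly, not a Frobenius norm, so [n 1] does not
     enter the root. *)
  by rewrite big_nat1 big_geq // sqrtr1 divr1; exact: norm2_residualS.
apply: le_trans (norm2_residualS je).
have j2e : (1 <= j.+2 <= e.+1)%N by exact: ltnW.
have rE := unfolding_residual As1 AsS (j := j.+1) je.
have := frobenius_le_maximizer (mxs (j := j.+2) je).
have -> : \sum_i \sum_k As j.+2 i k ^+ 2
    = dot (residual A As x j.+1) (residual A As x j.+1).
  by rewrite rE sum_sqr_reshape // big_ltn // ltnS ltnW.
(* The residual norm is the Frobenius norm of the next unfolding, hence at most [sqrt (n j.+2)]
   times its maximum. *)
rewrite -norm2_dot => /(le_trans (IH (ltnW je))) h.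
rewrite big_nat_recr //= (@big_nat_recr _ 1%N) //= natrM.
rewrite sqrtrM ?ler0n // invfM.
have f0 : 0 < f j.+2 by apply: is_N_factor_gt0; exact: hw.
have s0 : 0 < Num.sqrt (n j.+2)%:R :> R by rewrite sqrtr_gt0 ltr0n n_gt0.
move: h; rewrite -ler_pdivrMl // -(ler_pM2l f0); apply: le_trans.
by rewrite le_eqVlt; apply/orP; left; apply/eqP; ring.
Qed.

(** After [e] contractions a single mode is left, and [xs e.+1] is the normalized residual itself:
    this last step costs a factor [f] but no dimension. *)
Lemma multilin_output_ge :
    xs e.+1 = (norm2 (residual A As x e))^-1
                *: Defs.reshape (n e.+1) 1 (residual A As x e) ->
  f e.+1 * norm2 (residual A As x e) <= multilin A x.
Proof.
move=> xsE; set v := residual A As x e in xsE *.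
have pE : (\prod_(e.+1 <= k < e.+2) n k)%N = n e.+1 by rewrite big_nat1.
rewrite (multilin_residual As1 AsS (ltnSn e)) subSnn /kron.
rewrite (eq_bigr (fun r => entry v r * entry (x e.+1) (r %% n e.+1)%N));
  last by move=> r _; rewrite mulr1.
rewrite -(dot_column _ _ pE) -(norm2_column _ pE).
apply: dot_normalized_is_N; first by apply: hw; rewrite ltnSn.
by rewrite norm2_column // -xsE; apply: xN; rewrite ltnSn.
Qed.

End Output.

Unset Implicit Arguments.
Set Strict Implicit.

Theorem theorem3p1 (R : realType) (d : nat) (n : nat -> nat)
    (A : tensor R d n) (w : nat -> R) (x : forall j : nat, 'cV[R]_(n j))
    (hd : (3 <= d)%N)
    (hA : A != 0)
    (hw : forall j : nat, (1 <= j <= d)%N ->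
      0 <= w j < 1 / Num.sqrt ((n j)%:R : R))
    (hx : V1_output A w x)
    (xt : forall j : nat, 'cV[R]_(n j))
    (hxt : forall j : nat, (1 <= j <= d)%N -> norm2 (xt j) = 1) :
  let c := (\prod_(1 <= j < d.+1) (1 - w j * Num.sqrt (n j)%:R + w j))
           / Num.sqrt (\prod_(2 <= j < d) n j)%:R in
  multilin A x >= c * lambda_max (unfold1 A) /\
  c * lambda_max (unfold1 A) >= c * multilin A xt.
Proof.
case: d hd A hA hw hx hxt => [//|[//|e]] e0 A _ hw [As [xs [ys]]].
move=> [As1 AsS mxs xsd xN] hxt c.
have mx1 : is_maximizer (unfold1 A) (xs 1%N) (ys 1%N) by rewrite -As1; apply: mxs.
rewrite (lambda_max_maximizer mx1); split; last first.
  (* Since [c >= 0], the second inequality reduces to the maximality of [xs 1], [ys 1]. *)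
  rewrite ler_wpM2l ?multilin_le_maximizer // divr_ge0 ?sqrtr_ge0 // big_nat.
  by apply: prodr_ge0 => j jd; rewrite ltW // is_N_factor_gt0 // hw.
apply: le_trans (multilin_output_ge hw As1 AsS xN xsd).
(* The factor of mode [d] comes from the final inner product, the others from the bound on the last
   residual. *)
rewrite /c big_nat_recr //=.
have f0 := is_N_factor_gt0 (hw e.+2 (leqnn _)).
have := norm2_residual_ge hw As1 AsS mxs xN (ltnSn e).
rewrite -(ler_pM2l f0) As1; apply: le_trans.
by rewrite le_eqVlt; apply/orP; left; apply/eqP; ring.
Qed.
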